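(* Let $W$ be a finite group acting orthogonally on a Euclidean vector space $\mathfrak{t}$, preserving a lattice $\Gamma$ in $\mathfrak{t}$. Let $w\in W$ with $w\neq I$ and let $r$ be the rank of $I-w$. Let $g$ be the greatest common divisor of the $r\times r$-minors of the matrix of $I-w$ expressed in coordinates with respect to a basis for the dual lattice $\Gamma^\vee$. Then $$g=|F_w|.$$
   Context: $\mathfrak{t}$ is a finite-dimensional real inner product space and $\Gamma$ is a full-rank lattice in it; elements $w\in W$ are regarded as the orthogonal operators by which they act on $\mathfrak{t}$, and $I$ is the identity operator. The dual lattice is $\Gamma^\vee=\{x\in\mathfrak{t} : \langle x,y\rangle\in\mathbb{Z}\ \text{for all } y\in\Gamma\}$, which is preserved by $W$ (so the matrix of $I-w$ in a $\mathbb{Z}$-basis of $\Gamma^\vee$ is an integer matrix). Let $\mathcal{T}=\mathfrak{t}/\Gamma$ with the induced $W$-action, let $\mathcal{T}^w$ be the subgroup of points fixed by $w$, and let $\mathcal{T}^w_1$ be its identity component. $F_w=\mathcal{T}^w/\mathcal{T}^w_1$ is the (finite) component group. *)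

(* Defs.v *)
From HB Require Import structures.
From mathcomp Require Import all_fingroup.
From mathcomp Require Import all_boot all_order all_algebra.
From mathcomp Require Import sesquilinear ring.
From mathcomp Require Import all_classical all_reals all_analysis.
Import Order.TTheory GRing.Theory Num.Theory.
Import numFieldNormedType.Exports.
Set Implicit Arguments.
Unset Strict Implicit.
Unset Printing Implicit Defensive.
Local Open Scope classical_set_scope.
Local Open Scope quotient_scope.
Local Open Scope ring_scope.

(* MathComp-Analysis development.  A copy of the vector space [t], carrying the norm of the inner product
   [dot] and hence the Euclidean topology. *)
Definition euclid (R : realType) (t : vectType R) (dot : {dot t for idfun})
  : Type := t.

Section EuclideanNorm.
Variables (R : realType) (t : vectType R) (dot : {dot t for idfun}).

HB.instance Definition _ := Vector.copy (euclid dot) t.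

Definition euclid_norm (x : euclid dot) : R := Num.sqrt (dot x x).

Lemma dot_sym (x y : t) : dot x y = dot y x.
Proof. by rewrite hermC expr0 mul1r. Qed.

Lemma dot_ge0 (x : t) : 0 <= dot x x.
Proof.
have [->|x0] := eqVneq x 0; first by rewrite linear0l.
by apply: ltW; exact: neq0_dnorm_gt0.
Qed.

Lemma dot_cauchy_schwarz (x y : t) : dot x y ^+ 2 <= dot x x * dot y y.
Proof.
have [->|y0] := eqVneq y 0; first by rewrite linear0r expr0n mulr_ge0 ?dot_ge0.
have yy : 0 < dot y y by exact: neq0_dnorm_gt0.
have := dot_ge0 (dot y y *: x - dot x y *: y).
rewrite linearBl !linearBr /= !linearZl_LR !linearZr_LR /= (dot_sym y x).
rewrite (_ : _ - _ = dot y y * (dot x x * dot y y - dot x y ^+ 2)).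
  by rewrite pmulr_rge0 // subr_ge0.
by rewrite -![_ *: _]/(_ * _); ring.
Qed.

Lemma euclid_normD (x y : euclid dot) :
  euclid_norm (x + y) <= euclid_norm x + euclid_norm y.
Proof.
rewrite /euclid_norm -(ler_pXn2r (_ : 0 < 2)%N) ?nnegrE ?addr_ge0 ?sqrtr_ge0 //.
rewrite sqrrD !sqr_sqrtr ?dot_ge0 // -sqrtrM ?dot_ge0 //.
rewrite linearDl !linearDr /= (dot_sym y x).
have : dot x y <= Num.sqrt (dot x x * dot y y).
  apply: le_trans (ler_norm _) _; rewrite -sqrtr_sqr.
  by rewrite ler_wsqrtr // dot_cauchy_schwarz.
set a := Num.sqrt _; move=> xya.
rewrite addrA -(addrA (dot x x)) -mulr2n lerD2r lerD2l.
by rewrite lerMn2r xya orbT.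
Qed.

Lemma euclid_normZ (a : R) (x : euclid dot) :
  euclid_norm (a *: x) = `|a| * euclid_norm x.
Proof.
rewrite /euclid_norm linearZl_LR linearZr_LR /= mulrA -expr2.
by rewrite sqrtrM ?sqr_ge0 // sqrtr_sqr.
Qed.

Lemma euclid_norm_eq0 (x : euclid dot) : euclid_norm x = 0 -> x = 0.
Proof.
move/eqP; rewrite sqrtr_eq0 => xx; apply/eqP; apply: contraLR xx => x0.
by rewrite -ltNge; exact: neq0_dnorm_gt0.
Qed.

HB.instance Definition _ :=
  Lmodule_isNormed.Build R (euclid dot) euclid_normD euclid_normZ
    euclid_norm_eq0.

End EuclideanNorm.

Section Lattices.
Variables (R : realType) (t : vectType R).

Definition lattice_basis (L : set t) (b : (\dim {:t}).-tuple t) : Prop :=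
  basis_of {:t} b /\
  L = [set x | exists c : 'I_(\dim {:t}) -> int,
                 x = \sum_(i < \dim {:t}) b`_i *~ c i].

Definition full_rank_lattice (L : set t) : Prop :=
  exists b, lattice_basis L b.

Definition dual_lattice (dot : {dot t for idfun}) (L : set t) : set t :=
  [set x | forall y, L y -> dot x y \is a Num.int].

End Lattices.

Definition orthogonal_rep (R : realType) (t : vectType R)
    (dot : {dot t for idfun}) (W : finGroupType) (rho : W -> 'End(t)) : Prop :=
  [/\ rho 1%g = \1%VF,
      forall u v, rho (u * v)%g = (rho u \o rho v)%VF &
      forall u, isometry dot dot (rho u)].

Section Torus.
Variables (R : realType) (t : vectType R) (dot : {dot t for idfun}).
Variable Gamma : zmodClosed t.

Definition lattice_quot : Type :=
  @Quotient.quot (euclid dot) (Gamma : zmodClosed (euclid dot)).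
HB.instance Definition _ := GRing.Zmodule.on lattice_quot.
HB.instance Definition _ := Quotient.on lattice_quot.

(* The quotient group [t / Gamma] with the quotient of the Euclidean
   topology. *)
Definition torus : Type := quotient_topology lattice_quot.
HB.instance Definition _ := Topological.on torus.
HB.instance Definition _ := Quotient.on torus.
HB.instance Definition _ := GRing.Zmodule.copy torus lattice_quot.

Definition torus_pi (x : t) : torus := \pi_torus x.

Definition torus_act (f : 'End(t)) (X : torus) : torus :=
  torus_pi (f (repr X)).

Lemma torus_piE x y : torus_pi x = torus_pi y <-> x - y \in Gamma.
Proof.
have E := Quotient.idealrBE (Gamma : zmodClosed (euclid dot)) x y.
split=> [xy|xyG]; first by apply: (etrans E); apply/eqP.
exact: (eqP (etrans (esym E) xyG)).
Qed.

Lemma torus_piD x y : torus_pi (x + y) = torus_pi x + torus_pi y.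
Proof. exact: (@Quotient.pi_add (euclid dot)). Qed.

(* [torus_act f] is the map induced by [f] as soon as [f] preserves the
   lattice. *)
Lemma torus_actE (f : 'End(t)) x :
  {in Gamma, forall y, f y \in Gamma} ->
  torus_act f (torus_pi x) = torus_pi (f x).
Proof.
move=> fG; apply/torus_piE; rewrite -linearB; apply: fG.
by apply/torus_piE; rewrite /torus_pi reprK.
Qed.

Definition torus_fixed (f : 'End(t)) : set torus :=
  [set X | torus_act f X = X].

Definition torus_fixed1 (f : 'End(t)) : set torus :=
  connected_component (torus_fixed f) 0.

(* The quotient of the fixed-point group by its identity component, as the set
   of cosets. *)
Definition component_group (f : 'End(t)) : set (set torus) :=
  [set [set X + Y | Y in torus_fixed1 f] | X in torus_fixed f].

End Torus.

Arguments torus {R t} dot Gamma.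
Arguments torus_pi {R t} dot Gamma x.
Arguments torus_act {R t} dot Gamma f X.
Arguments torus_fixed {R t} dot Gamma f.
Arguments torus_fixed1 {R t} dot Gamma f.
Arguments component_group {R t} dot Gamma f.

Section Minors.
Variable n : nat.

Definition increasing r (f : {ffun 'I_r -> 'I_n}) : bool :=
  [forall i : 'I_r, forall j : 'I_r, (i < j)%N ==> (f i < f j)%N].

Definition gcd_minors (r : nat) (A : 'M[int]_n) : nat :=
  \big[gcdn/0%N]_(f : {ffun 'I_r -> 'I_n} | increasing f)
    \big[gcdn/0%N]_(g : {ffun 'I_r -> 'I_n} | increasing g)
      `|\det (mxsub f g A)|%N.

End Minors.

(* Main.v *)
Require Import Defs.
From HB Require Import structures.
From mathcomp Require Import all_fingroup.
From mathcomp Require Import all_boot all_order all_algebra.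
From mathcomp Require Import sesquilinear.
From mathcomp Require Import all_classical all_reals all_analysis.
Import Order.TTheory GRing.Theory Num.Theory.
Import numFieldNormedType.Exports.
Set Implicit Arguments.
Unset Strict Implicit.
Unset Printing Implicit Defensive.
Local Open Scope classical_set_scope.
Local Open Scope card_scope.
Local Open Scope ring_scope.

(** Let [N = I - w]. A point [x] of the vector space represents a fixed point of
    the torus when [N x] lies in [Gamma], and the identity component of the
    fixed-point group is the image of the kernel of [N]: that image is
    connected, and as [N] sends [N^-1(Gamma)] into the discrete set [Gamma], the
    subgroup [ker N + Gamma] is open and closed in [N^-1(Gamma)]
    ([torus_fixed1P]). Hence the component group is
    [N^-1(Gamma) / (ker N + Gamma)], a purely arithmetic object.

    It is computed with an integral matrix. If [b] is a basis of the dual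
    lattice, the coordinates [dot b_i x] identify [Gamma] with the integral
    vectors ([mem_lattice_dual_coord]), and by orthogonality the transpose of the matrix
    [A] of [N] on the dual lattice acts on these coordinates as [I - w^-1]
    ([dual_coord_displacement]). As [I - w^-1 = - w^-1 N] and [w] preserves
    [Gamma], replacing [N] by [I - w^-1] changes neither the kernel nor the
    preimage of [Gamma].

    Take a Smith decomposition [A = L D U] with [L], [U] unimodular and [D]
    diagonal with nonzero entries [d_1, ..., d_r]. The change of coordinates by
    [L^T] turns the component group into the set of [y] with every [d_i y_i]
    integral modulo the set of [y] with every [y_i] integral, [i <= r]; it has
    [|d_1 ... d_r|] elements ([component_group_card]). On the other hand the gcd
    of the [r]-minors is unchanged by unimodular factors ([gcd_minors_unitl],
    [gcd_minors_unitr]), because minors of a product are integral combinations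
    of minors of either factor; and for [D] the only nonzero [r]-minor is
    [d_1 ... d_r] ([gcd_minors_diag]). *)

(** * Minors of integer matrices *)

(** The expansion behind the Cauchy-Binet formula: the summands with [f] not
    injective vanish, and grouping the others by image would give the formula
    itself. The ungrouped sum is enough to propagate a common divisor. *)
Lemma det_mulmx_rowsub (R : comNzRingType) r n (X : 'M[R]_(r, n))
    (Y : 'M[R]_(n, r)) :
  \det (X *m Y) =
  \sum_(f : {ffun 'I_r -> 'I_n}) (\prod_i X i (f i)) * \det (rowsub f Y).
Proof.
transitivity (\sum_(s : 'S_r) \sum_(f : {ffun 'I_r -> 'I_n})
   (-1) ^+ s * ((\prod_i X i (f i)) * \prod_i Y (f i) (s i))).
  apply: eq_bigr => s _; rewrite -big_distrr /=; congr (_ * _).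
  under eq_bigr do rewrite mxE.
  rewrite bigA_distr_bigA /=.
  by apply: eq_bigr => f _; rewrite big_split.
rewrite exchange_big /=; apply: eq_bigr => f _.
rewrite /determinant big_distrr /=; apply: eq_bigr => s _.
rewrite mulrCA; do 2![congr (_ * _)].
by apply: eq_bigr => i _; rewrite mxE.
Qed.

Lemma increasingP n r (f : {ffun 'I_r -> 'I_n}) :
  reflect {homo f : i j / (i < j)%N} (increasing f).
Proof.
apply: (iffP forallP) => [fI i j ij|fI i].
  by have /forallP/(_ j)/implyP := fI i; apply.
by apply/forallP => j; apply/implyP; exact: fI.
Qed.

(** Minors on arbitrary, repeated or unsorted, rows reduce to those on
    increasing rows through this factorization. *)
Lemma increasing_rearrangement n r (f : 'I_r -> 'I_n) : injective f ->
  exists h : {ffun 'I_r -> 'I_n}, increasing h /\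
  exists s : 'S_r, forall i, f i = h (s i).
Proof.
move=> fI; pose le := (fun i j : 'I_n => (i <= j)%N).
pose u := mktuple f.
have ltot : total le by move=> i j; exact: leq_total.
have ltr : transitive le by move=> i j k; exact: leq_trans.
have [s us] : exists s : 'S_r,
    u = [tuple tnth (sort_tuple le u) (s i) | i < r] :> seq _.
  by apply/tuple_permP; rewrite perm_sym /= perm_sort.
exists [ffun i => tnth (sort_tuple le u) i]; split; last first.
  exists s => i; rewrite ffunE.
  have -> : f i = tnth u i by rewrite tnth_mktuple.
  by move/val_inj: us => {1}->; rewrite tnth_mktuple.
apply/increasingP => i j ij; rewrite !ffunE.
have su : sorted (fun i j : 'I_n => (i < j)%N) (sort le u).
  have : sorted ltn (map val (sort le u)).
    rewrite ltn_sorted_uniq_leq (map_inj_uniq val_inj) sort_uniq.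
    rewrite map_inj_uniq // enum_uniq /= sorted_map; exact: sort_sorted.
  by rewrite sorted_map.
pose x0 := f i; rewrite !(tnth_nth x0) /=.
apply: (sorted_ltn_nth _ x0 su) => //; first by move=> a b c; exact: ltn_trans.
  by rewrite inE size_sort size_tuple.
by rewrite inE size_sort size_tuple.
Qed.

Lemma dvdn_gcd_minorsP n r (A : 'M[int]_n) (d : nat) :
  reflect (forall f g : {ffun 'I_r -> 'I_n}, increasing f -> increasing g ->
             (d %| `|\det (mxsub f g A)|)%N)
          (d %| gcd_minors r A)%N.
Proof.
apply: (iffP (dvdn_biggcdP _ _ _)) => [dA f g fI gI|dA f fI].
  by have /dvdn_biggcdP/(_ g gI) := dA f fI.
by apply/dvdn_biggcdP => g; exact: dA.
Qed.

(** A repeated row gives a zero minor and a permutation of the rows only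
    changes the sign, so restricting the gcd to increasing selections loses
    nothing; columns follow by transposition. *)
Lemma gcd_minors_dvd n r (A : 'M[int]_n) (f g : 'I_r -> 'I_n) :
  (gcd_minors r A %| `|\det (mxsub f g A)|)%N.
Proof.
have tr (B : 'M[int]_n) h k : \det (mxsub h k B) = \det (mxsub k h B^T) :> int.
  by rewrite -det_tr; congr (\det _); apply/matrixP => i j; rewrite !mxE.
have row (B : 'M[int]_n) (h k : 'I_r -> 'I_n) d :
    (forall h' : {ffun 'I_r -> 'I_n}, increasing h' ->
      (d %| `|\det (mxsub h' k B)|)%N) ->
    (d %| `|\det (mxsub h k B)|)%N.
  move=> dB; have [/injectiveP hI|] := boolP (injectiveb h); last first.
    case/injectivePn => i [j ij hij].
    rewrite (determinant_alternate ij) ?dvdn0 // => l.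
    by rewrite !mxE hij.
  have [h' [h'I [s hs]]] := increasing_rearrangement hI.
  rewrite (_ : mxsub h k B = row_perm s (mxsub h' k B)); last first.
    by apply/matrixP => i j; rewrite !mxE hs.
  by rewrite row_permE det_mulmx det_perm abszM abszX /= exp1n mul1n dB.
apply: (row) => f' f'I; rewrite tr; apply: row => g' g'I; rewrite -tr.
exact/dvdn_gcd_minorsP.
Qed.

Lemma gcd_minors_trmx n r (A : 'M[int]_n) : gcd_minors r A^T = gcd_minors r A.
Proof.
have H (B : 'M[int]_n) : (gcd_minors r B %| gcd_minors r B^T)%N.
  apply/dvdn_gcd_minorsP => f g _ _.
  rewrite -trmx_mxsub det_tr; exact: gcd_minors_dvd.
by apply/eqP; rewrite eqn_dvd H andbT -{2}[A]trmxK H.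
Qed.

(** Every minor of a product is a combination of minors of the right factor.
    Applied to [L] and to its inverse, this makes the gcd of the minors an
    invariant of the matrix up to unimodular equivalence. *)
Lemma gcd_minors_dvd_mull n r (L A : 'M[int]_n) :
  (gcd_minors r A %| gcd_minors r (L *m A))%N.
Proof.
apply/dvdn_gcd_minorsP => f g _ _.
rewrite (_ : mxsub f g (L *m A) = rowsub f L *m colsub g A); last first.
  by apply/matrixP => i j; rewrite !mxE; apply: eq_bigr => k _; rewrite !mxE.
rewrite det_mulmx_rowsub -[X in (X %| _)%N]absz_nat -dvdzE.
apply: rpred_sum => h _.
apply: dvdz_mull; rewrite dvdzE /= -mxsub_comp; exact: gcd_minors_dvd.
Qed.

Lemma gcd_minors_unitl n r (L A : 'M[int]_n) :
  L \in unitmx -> gcd_minors r (L *m A) = gcd_minors r A.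
Proof.
move=> uL; apply/eqP; rewrite eqn_dvd gcd_minors_dvd_mull andbT.
by rewrite -{2}[A](mulKmx uL) gcd_minors_dvd_mull.
Qed.

Lemma gcd_minors_unitr n r (A U : 'M[int]_n) :
  U \in unitmx -> gcd_minors r (A *m U) = gcd_minors r A.
Proof.
move=> uU; rewrite -gcd_minors_trmx trmx_mul gcd_minors_unitl ?unitmx_tr //.
exact: gcd_minors_trmx.
Qed.

(** * Minors and rank of a Smith normal form *)

Lemma increasing_bounded n k (kn : (k <= n)%N) (f : {ffun 'I_k -> 'I_n}) :
  increasing f -> (forall i, (f i < k)%N) -> f =1 widen_ord kn.
Proof.
move=> /increasingP fI fk.
have step m (i j : 'I_k) : j = (i + m)%N :> nat -> (f i + m <= f j)%N.
  elim: m j => [|m IHm] j ij.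
    by rewrite addn0 (_ : i = j) //; apply: val_inj; rewrite /= ij addn0.
  have imk : (i + m < k)%N by rewrite (leq_trans _ (ltn_ord j)) // ij addnS.
  rewrite addnS (leq_ltn_trans (IHm (Ordinal imk) _)) //.
  by apply: fI; rewrite /= ij addnS.
move=> i; apply: val_inj => /=.
have k0 : (0 < k)%N by exact: leq_ltn_trans (ltn_ord i).
have k1 : (k.-1 < k)%N by rewrite ltn_predL.
apply/eqP; rewrite eqn_leq; apply/andP; split.
  have ik : (i <= k.-1)%N by rewrite -ltnS prednK.
  have := step (k.-1 - i)%N i (Ordinal k1).
  rewrite /= subnKC // => /(_ erefl) h.
  have := leq_trans h (_ : f (Ordinal k1) <= k.-1)%N.
  rewrite -ltnS prednK // fk => /(_ isT).
  by rewrite -{2}(subnK ik) addnC leq_add2l.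
by apply: leq_trans (step i (Ordinal k0) i erefl); exact: leq_addl.
Qed.

(** With [k] the rank, a selection using an index outside the first [k] meets
    a zero line, and only one increasing selection avoids them: a single minor
    is nonzero. *)
Lemma gcd_minors_diag n k (d : 'rV[int]_n) : (k <= n)%N ->
  (forall i, (d 0 i != 0) = (i < k)%N) ->
  gcd_minors k (diag_mx d) = (\prod_(i | d 0%R i != 0%R) `|d 0%R i|)%N.
Proof.
move=> kn dk; pose f0 := [ffun i => widen_ord kn i].
have minor0 : `|\det (mxsub f0 f0 (diag_mx d))|%N =
    (\prod_(i | d 0%R i != 0%R) `|d 0%R i|)%N.
  rewrite (_ : mxsub _ _ _ = diag_mx (\row_i d 0 (widen_ord kn i))); last first.
    by apply/matrixP => i j; rewrite !mxE !ffunE.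
  rewrite det_diag (big_morph absz abszM absz1).
  under [RHS]eq_bigl do rewrite dk.
  by rewrite (big_ord_narrow kn); apply: eq_bigr => i _; rewrite mxE.
apply/eqP; rewrite eqn_dvd -{1}minor0 gcd_minors_dvd /=.
apply/dvdn_gcd_minorsP => f g fI gI.
have [fk|] := boolP [forall i, f i < k]%N; last first.
  rewrite negb_forall => /existsP[i fi].
  rewrite (expand_det_row _ i) [X in absz X]big1 ?dvdn0 // => j _.
  have /eqP -> : mxsub f g (diag_mx d) i j == 0; last by rewrite mul0r.
  by move: fi; rewrite -dk negbK !mxE => /eqP ->; rewrite mul0rn.
have [gk|] := boolP [forall i, g i < k]%N; last first.
  rewrite negb_forall => /existsP[i gi].
  rewrite (expand_det_col _ i) [X in absz X]big1 ?dvdn0 // => j _.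
  have /eqP -> : mxsub f g (diag_mx d) j i == 0; last by rewrite mul0r.
  rewrite !mxE; case: (f j =P g i) => [->|_]; last by rewrite mulr0n.
  by move: gi; rewrite -dk negbK => /eqP ->; rewrite mul0rn.
rewrite -minor0.
have eq_f0 (h : {ffun 'I_k -> 'I_n}) :
    increasing h -> [forall i, h i < k]%N -> h = f0.
  move=> hI /forallP hk; apply/ffunP => i.
  by rewrite ffunE (increasing_bounded kn hI).
by rewrite (eq_f0 f) // (eq_f0 g).
Qed.

(** The rank over a field of characteristic zero sees exactly the nonzero
    entries: the matrix is a partial identity times an invertible diagonal. *)
Lemma rank_intr_diag (F : numFieldType) n k (d : 'rV[int]_n) : (k <= n)%N ->
  (forall i, (d 0 i != 0) = (i < k)%N) ->
  \rank (map_mx intr (diag_mx d) : 'M[F]_n) = k.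
Proof.
move=> kn dk.
pose e : 'rV[F]_n := \row_i (if (i < k)%N then (d 0 i)%:~R else 1).
rewrite (_ : map_mx _ _ = pid_mx k *m diag_mx e); last first.
  apply/matrixP => i j; rewrite mul_mx_diag !mxE -dk rmorphMn /=.
  case: eqVneq => [->|ne]; rewrite ?mulr1n ?mulr0n.
    rewrite eqxx dk; case: ifPn => [_|]; rewrite ?mul1r // -dk negbK.
    by move=> /eqP ->; rewrite mul0r.
  by rewrite (negbTE (ne : i != j :> nat)) mul0r.
rewrite mxrankMfree ?rank_pid_mx // row_free_unit unitmxE det_diag unitfE.
apply/prodf_neq0 => i _; rewrite mxE; case: ifP => [|_]; last exact: oner_neq0.
by rewrite -dk intr_eq0.
Qed.

(** The divisibility chain of the Smith form pushes the zeros to the end,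
    since [0] divides nothing but [0]. *)
Lemma smith_diag n (A : 'M[int]_n) :
  exists L U : 'M[int]_n, exists d : 'rV[int]_n,
  [/\ L \in unitmx, U \in unitmx, A = L *m diag_mx d *m U &
      exists2 k, (k <= n)%N & forall i, (d 0 i != 0) = (i < k)%N].
Proof.
have [L uL [U uU [s ss AE]]] := int_Smith_normal_form A.
exists L, U, (\row_i s`_i); split=> //.
  by rewrite AE; congr (_ *m _ *m _); apply/matrixP => i j; rewrite !mxE.
have szero i j : (i <= j)%N -> s`_i = 0 -> s`_j = 0.
  move=> ij si0; have [js|] := ltnP j (size s); last exact: nth_default.
  apply/eqP; rewrite -dvd0z -[X in (X %| _)%Z]si0.
  have dvd_tr : transitive dvdz by move=> x y z; exact: dvdz_trans.
  have /(_ i j) := sorted_leq_nth dvd_tr dvdzz 0 ss.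
  by rewrite !inE; apply=> //; exact: leq_ltn_trans js.
pose a := mkseq (nth 0 s) n; exists (find (pred1 0) a).
  by rewrite -[X in (_ <= X)%N](size_mkseq (nth 0 s)) find_size.
move=> i; rewrite mxE; have [ik|ki] := ltnP i (find (pred1 0) a).
  by have /= := before_find 0 ik; rewrite nth_mkseq // => ->.
have ha : has (pred1 0) a by rewrite has_find (leq_ltn_trans ki) // size_mkseq.
have /= := nth_find 0 ha.
rewrite nth_mkseq ?(leq_ltn_trans ki) // => /eqP /(szero _ _ ki) ->.
by rewrite eqxx.
Qed.


(** * Dual bases and dual lattices *)

Section DualBases.
Variables (R : realType) (t : vectType R) (dot : {dot t for idfun}).
Local Notation n := (\dim {:t}).

Lemma basis_dot_eq0 (b : n.-tuple t) (x : t) :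
  basis_of {:t} b -> (forall i : 'I_n, dot b`_i x = 0) -> x = 0.
Proof.
move=> bb bx; apply/eqP; apply: contraT => x0.
have : 0 < dot x x by exact: neq0_dnorm_gt0.
rewrite {1}(coord_basis bb (memvf x)) linear_sumlz big1 ?ltxx // => i _.
by rewrite linearZl_LR /= bx mulr0.
Qed.

(** The Gram matrix is invertible because the form is definite; the columns of
    its inverse are the coordinates of the dual basis. *)
Lemma dual_basis_exists (b : n.-tuple t) : basis_of {:t} b ->
  exists v : 'I_n -> t, forall i j : 'I_n, dot b`_i (v j) = (i == j)%:R.
Proof.
move=> bb; pose G : 'M[R]_n := \matrix_(i, j) dot b`_i b`_j.
have uG : G \in unitmx.
  rewrite -row_free_unit; apply: inj_row_free => u uG0.
  have /eqP : passmx.vecof b u = 0.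
    apply: (basis_dot_eq0 bb) => j.
    have /rowP/(_ j) := uG0; rewrite !mxE => <-.
    rewrite linear_sumr; apply: eq_bigr => i _.
    by rewrite linearZr_LR mxE /= dot_sym.
  by rewrite passmx.vecof_eq0 // => /eqP.
exists (fun j => \sum_k invmx G k j *: b`_k) => i j.
have /matrixP/(_ i j) := mulmxV uG; rewrite !mxE => <-.
rewrite linear_sumr; apply: eq_bigr => k _.
by rewrite linearZr_LR /= mxE mulrC.
Qed.

Definition dual_coord (b : n.-tuple t) (x : t) : 'cV[R]_n :=
  \col_i dot b`_i x.

Lemma dual_coord_is_linear (b : n.-tuple t) : linear (dual_coord b).
Proof.
by move=> a x y; apply/colP => i; rewrite !mxE linearDr linearZr_LR.
Qed.
HB.instance Definition _ (b : n.-tuple t) :=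
  GRing.isSemilinear.Build R t 'cV[R]_n _ (dual_coord b)
    (GRing.semilinear_linear (dual_coord_is_linear b)).

Lemma dual_coord_eq0 (b : n.-tuple t) x :
  basis_of {:t} b -> dual_coord b x = 0 -> x = 0.
Proof.
move=> bb bx; apply: (basis_dot_eq0 bb) => i.
by have /colP/(_ i) := bx; rewrite !mxE.
Qed.

Lemma dual_coord_surj (b : n.-tuple t) (c : 'cV[R]_n) :
  basis_of {:t} b -> exists x, dual_coord b x = c.
Proof.
move=> bb; have [v bv] := dual_basis_exists bb.
exists (\sum_j c j 0 *: v j); apply/colP => i; rewrite mxE linear_sumr.
rewrite (bigD1 i) //= linearZr_LR /= bv eqxx mulr1 big1 ?addr0 // => j ji.
by rewrite linearZr_LR /= bv eq_sym (negbTE ji) mulr0.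
Qed.

Lemma lattice_basisP (L : set t) (b : n.-tuple t) x : lattice_basis L b ->
  L x <-> forall i, coord b i x \is a Num.int.
Proof.
move=> [bb ->]; split=> [[c ->] i|xi].
  under eq_bigr do rewrite -scaler_int.
  by rewrite coord_sum_free ?(basis_free bb) // intr_int.
exists (fun i => Num.floor (coord b i x)).
rewrite {1}(coord_basis bb (memvf x)); apply: eq_bigr => i _.
by rewrite -scaler_int; have := xi i; rewrite intrEfloor => /eqP ->.
Qed.

Lemma lattice_basis_mem (L : set t) (b : n.-tuple t) (i : 'I_n) :
  lattice_basis L b -> L b`_i.
Proof.
move=> bL; apply/(lattice_basisP _ bL) => j.
by rewrite coord_free ?(basis_free bL.1).
Qed.

(** A full-rank lattice is its own double dual, so the coordinates [dot b_i x]
    against a basis [b] of the dual lattice detect membership. The proof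
    recovers the coordinates of [x] on a basis of [L] as pairings with the
    dual basis, whose vectors are integral combinations of [b]. *)
Lemma mem_lattice_dual_coord (L : set t) (b : n.-tuple t) x :
  full_rank_lattice L -> lattice_basis (dual_lattice dot L) b ->
  L x <-> dual_coord b x \is a mxOver Num.int.
Proof.
move=> [e eL] bL; have eb := eL.1; have bb := bL.1.
split=> [Lx|/mxOverP xint].
  by apply/mxOverP => i j; rewrite mxE; exact: (lattice_basis_mem i bL).
apply/(lattice_basisP _ eL) => i.
have [v ev] := dual_basis_exists eb.
have vdot j y : dot (v j) y = coord e j y.
  rewrite {1}(coord_basis eb (memvf y)) linear_sumr (bigD1 j) //=.
  rewrite linearZr_LR /= dot_sym ev eqxx mulr1 big1 ?addr0 // => k kj.
  by rewrite linearZr_LR /= dot_sym ev (negbTE kj) mulr0.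
have vdual : dual_lattice dot L (v i).
  by move=> y /(lattice_basisP _ eL)/(_ i); rewrite vdot.
have /(lattice_basisP _ bL) vint := vdual.
rewrite -vdot (coord_basis bb (memvf (v i))) linear_sumlz.
apply: rpred_sum => j _; rewrite linearZl_LR /=; apply: rpredM => //.
by have := xint j 0; rewrite mxE.
Qed.

End DualBases.

(** * The identity component of the fixed-point group *)

Section TorusTopology.
Variables (R : realType) (t : vectType R) (dot : {dot t for idfun}).
Variable Gamma : zmodClosed t.
Local Notation pi := (torus_pi dot Gamma).

Lemma dot_le_norm (x y : t) :
  `|dot x y| <= `|x : euclid dot| * `|y : euclid dot|.
Proof.
rewrite -sqrtr_sqr -sqrtrM ?dot_ge0 //.
by rewrite ler_wsqrtr // dot_cauchy_schwarz.
Qed.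

Lemma dot_continuous (c : t) : continuous (dot c : euclid dot -> R).
Proof.
move=> x; have xF : Filter (nbhs x) by exact: nbhs_filter.
apply/(@cvgrPdist_lt _ _ _ _ xF) => e e0.
have c0 : 0 < `|c : euclid dot| + 1 by rewrite ltr_wpDl.
apply/nbhs_ballP; exists (e / (`|c : euclid dot| + 1)) => /=.
  exact: divr_gt0.
move=> y.
rewrite -ball_normE /ball_ /= ltr_pdivlMr // => xy.
rewrite -linearBr (le_lt_trans (dot_le_norm _ _)) // (le_lt_trans _ xy) //.
by rewrite mulrC ler_wpM2l // lerDl.
Qed.

Lemma torus_pi_surj (X : torus dot Gamma) : exists x, X = pi x.
Proof. by exists (repr X); rewrite /torus_pi reprK. Qed.

Lemma torus_pi0 : pi 0 = 0.
Proof. by apply: (addrI (pi 0)); rewrite addr0 -torus_piD addr0. Qed.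

Lemma torus_pi_continuous : continuous (pi : euclid dot -> torus dot Gamma).
Proof. exact: pi_continuous. Qed.

Lemma torus_fixedP (f : 'End(t)) x : {in Gamma, forall y, f y \in Gamma} ->
  torus_fixed dot Gamma f (pi x) <-> x - f x \in Gamma.
Proof.
move=> fG; rewrite /torus_fixed /= torus_actE //; split=> [/esym|h].
  by move/torus_piE.
by apply/esym/torus_piE.
Qed.

(** The image in the torus of a neighbourhood of [S] whose width is measured
    by the forms [dot (phi i)] instead of the norm: when these are
    integer-valued, a width below [1] leaves only the value [0], which is how
    the discreteness of [Gamma] enters. *)
Definition torus_tube m (phi : 'I_m -> t) (S : set t) : set (torus dot Gamma) :=
  [set X | exists z y,
    [/\ X = pi z, S y & forall i, `|dot (phi i) (z - y)| < 1]].

Lemma open_torus_tube m (phi : 'I_m -> t) (S : set t) :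
  (forall x g, S x -> g \in Gamma -> S (x + g)) -> open (torus_tube phi S).
Proof.
move=> SG.
suff : open ((pi : euclid dot -> torus dot Gamma) @^-1` torus_tube phi S) by [].
rewrite openE => x [z [y [/torus_piE xz Sy zy]]].
have xF : Filter (nbhs (x : euclid dot)) by exact: nbhs_filter.
apply: filterS (_ : nbhs (x : euclid dot) [set x' | forall i,
    `|dot (phi i) (x' - (y + (x - z)))| < 1]).
  move=> x' x'y; exists x', (y + (x - z)); split=> //; exact: SG.
apply: (filter_forall xF) => i.
have /(@cvgrPdist_lt _ _ _ _ xF) := @dot_continuous (phi i) x.
have e0 : 0 < 1 - `|dot (phi i) (z - y)| by rewrite subr_gt0.
move=> /(_ _ e0); apply: filterS => x' /=.
rewrite ltrBrDr distrC => h.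
rewrite (_ : _ - _ = (x' - x) + (z - y)) ?linearDr /=; last first.
  rewrite -[RHS]addrA opprD opprB; congr (_ + _).
  by rewrite addrCA [RHS]addrCA [- y - x]addrC.
apply: le_lt_trans (ler_normD _ _) _; apply: le_lt_trans h.
by rewrite linearBr !linearNr.
Qed.

(** The fixed vectors of [f] map onto a connected set, as each one is joined
    to [0] by a segment of fixed vectors. Conversely the functions
    [dot (phi i)] take integer values on the preimage of the fixed-point group
    and vanish together only on fixed vectors, so the
    fixed-point group meets an open tube around a union of translates of the
    fixed space modulo [Gamma] only in that union: the image of the fixed space
    is open and closed in the fixed-point group. *)
Lemma torus_fixed1P m (f : 'End(t)) (phi : 'I_m -> t) x :
  {in Gamma, forall y, f y \in Gamma} ->
  (forall y, y - f y \in Gamma -> forall i, dot (phi i) y \is a Num.int) ->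
  (forall y, (forall i, dot (phi i) y = 0) -> f y = y) ->
  torus_fixed1 dot Gamma f (pi x) <-> exists2 y, f y = y & x - y \in Gamma.
Proof.
move=> fG phi_int phi0; split; last first.
  move=> [y fy /torus_piE ->].
  pose g (s : R) := pi (s *: y).
  have g_cont : continuous g.
    move=> s; apply: (@continuous_comp R (euclid dot) (torus dot Gamma)
        (fun s => s *: (y : euclid dot)) pi s).
      exact: (@scalel_continuous _ (euclid dot) y).
    exact: torus_pi_continuous.
  have : [set g s | s in `[0, 1]] (pi y).
    by exists 1; [rewrite /= in_itv /= ler01 lexx|rewrite /g scale1r].
  apply: connected_component_max.
  - by exists 0; [rewrite /= in_itv /= ler01 lexx|rewrite /g scale0r torus_pi0].
  - move=> _ [s _ <-]; apply/torus_fixedP => //.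
    by rewrite linearZ /= fy subrr rpred0.
  - apply: connected_continuous_connected; first exact: segment_connected.
    exact: continuous_subspaceT.
have fixD y g : y - f y \in Gamma -> g \in Gamma ->
    (y - g) - f (y - g) \in Gamma.
  move=> yf gG; rewrite linearB /= opprB [f g - _]addrC addrACA.
  by rewrite rpredD // rpredD ?rpredN ?fG.
pose S0 := [set y | exists2 k, f k = k & y - k \in Gamma].
pose S1 := [set y | y - f y \in Gamma /\ ~ S0 y].
pose U := torus_tube phi.
have S0G y g : S0 y -> g \in Gamma -> S0 (y + g).
  by move=> [k fk yk] gG; exists k => //; rewrite addrAC rpredD.
have S1G y g : S1 y -> g \in Gamma -> S1 (y + g).
  move=> [yf yS] gG; split; first by rewrite -[g]opprK fixD // rpredN.
  move=> yg; apply: yS; rewrite -(addrK g y).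
  by apply: S0G => //; rewrite rpredN.
have S0fix y : S0 y -> y - f y \in Gamma.
  move=> [k fk yk]; rewrite (_ : y - f y = (y - k) - f (y - k)).
    by rewrite rpredB // fG.
  by rewrite linearB /= fk opprB addrA subrK.
(* If [y] and [y'] represent fixed points and lie in a common tube, the forms
   [dot (phi i)] vanish on their difference modulo [Gamma]. *)
have US (S : set t) y : (forall y, S y -> y - f y \in Gamma) ->
    (forall y k, S y -> f k = k -> S (y + k)) ->
    (forall y g, S y -> g \in Gamma -> S (y + g)) ->
    y - f y \in Gamma -> U S (pi y) -> S y.
  move=> Sf Sk SG yf [z [y' [/torus_piE yz Sy' zy']]].
  have zf : z - f z \in Gamma.
    by rewrite -[z](subKr y) (fixD _ _ yf yz).
  have fixed : f (z - y') = z - y'.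
    apply: phi0 => i.
    have : dot (phi i) (z - y') \is a Num.int.
      apply: phi_int; rewrite linearB /= opprB [f y' - _]addrC addrACA.
      by rewrite [- y' + _]addrC -[f y' - y']opprB rpredB // Sf.
    move=> zint; apply/eqP; apply: contraT => /(norm_intr_ge1 zint).
    by rewrite leNgt zy'.
  rewrite -[y](subrK z) addrC; apply: SG => //.
  by rewrite -[z](subrK y') addrC; apply: Sk.
move=> T1x; set C := torus_fixed1 dot Gamma f in T1x.
have Cfix X : C X -> exists2 y, X = pi y & y - f y \in Gamma.
  have [y ->] := torus_pi_surj X; move=> /connected_component_sub Xfix.
  by exists y => //; apply/torus_fixedP.
have S0_add y k : S0 y -> f k = k -> S0 (y + k).
  move=> [l fl yl] fk; exists (l + k); first by rewrite linearD /= fl fk.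
  by rewrite opprD addrACA subrr addr0.
have S1_add y k : S1 y -> f k = k -> S1 (y + k).
  move=> [yf yS] fk; split.
    by rewrite linearD /= fk opprD addrACA subrr addr0.
  move=> yk; apply: yS; rewrite -(addrK k y); apply: S0_add => //.
  by rewrite linearN /= fk.
have US0 y : y - f y \in Gamma -> U S0 (pi y) -> S0 y by exact: US.
have US1 y : y - f y \in Gamma -> U S1 (pi y) -> S1 y.
  by apply: US => // y' [].
have SU (S : set t) y : S y -> U S (pi y).
  by move=> Sy; exists y, y; split=> // i; rewrite subrr linear0r normr0.
have S00 : S0 0 by exists 0; [exact: linear0|rewrite subrr rpred0].
(* Connectedness: the tubes around [S0] and its complement [S1] exhibit the
   trace of [S0] as both open and closed in [C]. *)
have CE : C `&` U S0 = C.
  apply: (@component_connected _ (torus_fixed dot Gamma f) 0).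
  - exists 0; split; last by rewrite -torus_pi0; exact: SU.
    apply: connected_component_refl; rewrite -torus_pi0.
    by apply/torus_fixedP => //; rewrite linear0 subrr rpred0.
  - by exists (U S0) => //; exact: open_torus_tube.
  - exists (~` U S1); first by apply: open_closedC; exact: open_torus_tube.
    apply/seteqP; split=> X [CX UX]; split=> //; have [y Xy yf] := Cfix X CX.
      rewrite Xy => /(US1 _ yf)[_]; apply; apply: US0 => //.
      by rewrite -Xy.
    rewrite Xy; apply: (SU); apply: contrapT => nS0; apply: UX.
    by rewrite Xy; apply: SU.
have xf : x - f x \in Gamma.
  by apply/torus_fixedP => //; exact: connected_component_sub T1x.
by move: T1x; rewrite -CE => -[_ /(US0 _ xf)].
Qed.

End TorusTopology.

(** * Counting the components *)

(** In the coordinates [Y], where the lattice is integral and the displacement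
    is diagonal with entries [d_i], a point is fixed in the torus when each
    [d_i * Y_i] is an integer, and lies in the identity component when [Y_i]
    itself is an integer for every nonzero [d_i]. Representatives of the
    components are then the points with coordinates [k_i / |d_i|],
    [0 <= k_i < |d_i|]. *)
Section ComponentCount.
Variables (R : realType) (t : vectType R) (dot : {dot t for idfun}).
Variable Gamma : zmodClosed t.
Local Notation pi := (torus_pi dot Gamma).
Variables (f : 'End(t)) (N : nat) (Y : {linear t -> 'cV[R]_N}).
Variable d : 'rV[int]_N.
Hypothesis fG : {in Gamma, forall y, f y \in Gamma}.
Hypothesis Y_surj : forall c, exists x, Y x = c.
Hypothesis fixedP : forall x,
  x - f x \in Gamma <-> forall i, (d 0 i)%:~R * Y x i 0 \is a Num.int.
Hypothesis fixed1P : forall x, torus_fixed1 dot Gamma f (pi x) <->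
  forall i, d 0 i != 0 -> Y x i 0 \is a Num.int.

Let coset x : set (torus dot Gamma) :=
  [set pi x + Z | Z in torus_fixed1 dot Gamma f].

Lemma coset_eqP x y : coset x = coset y <->
  forall i, d 0 i != 0 -> Y x i 0 - Y y i 0 \is a Num.int.
Proof.
have T1B u v : (torus_fixed1 dot Gamma f (pi (u - v))) <->
    forall i, d 0 i != 0 -> Y u i 0 - Y v i 0 \is a Num.int.
  by split=> [/fixed1P h i /h|h]; [|apply/fixed1P => i /h];
    rewrite linearB !mxE.
have sub u v : torus_fixed1 dot Gamma f (pi (u - v)) -> coset u `<=` coset v.
  move=> uv _ [Z Z1 <-]; have [z zE] := torus_pi_surj Z.
  exists (pi (u - v + z)).
    move: Z1; rewrite zE => /fixed1P Z1; apply/fixed1P => i di.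
    by rewrite linearD mxE rpredD ?Z1 //; move/fixed1P : uv; apply.
  by rewrite zE -!torus_piD addrA addrCA subrr addr0.
split=> [xy|/T1B xy].
  apply/T1B; have : coset x (pi x).
    exists (pi 0); last by rewrite -torus_piD addr0.
    by apply/fixed1P => i _; rewrite linear0 mxE.
  rewrite xy => -[Z Z1]; have [z zE] := torus_pi_surj Z; rewrite zE -torus_piD.
  move=> /torus_piE yzx.
  rewrite (_ : pi (x - y) = Z) // zE; apply/torus_piE.
  by rewrite -addrA -opprD -rpredN opprB.
apply/seteqP; split; apply: sub => //.
by apply/T1B => i di; rewrite -opprB rpredN; move/T1B : xy; apply.
Qed.

(* A zero entry contributes no component; the value [1] makes its index set a
   singleton and sends its coordinate [k_i / m_i] to [0]. *)
Let m i := if d 0 i == 0 then 1%N else `|d 0%R i|%N.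

Let m_gt0 i : (0 < m i)%N.
Proof. by rewrite /m; case: eqVneq; rewrite // absz_gt0. Qed.

Let abs_mul_int (x : R) i : d 0 i != 0 ->
  (d 0 i)%:~R * x \is a Num.int = ((m i)%:R * x \is a Num.int).
Proof.
move=> di; rewrite /m (negbTE di) natr_absz -[in LHS](mulr_sign_norm (d 0 i)).
by case: (d 0 i < 0)%R; rewrite ?mul1r // mulN1r rmorphN mulNr rpredN.
Qed.

Lemma component_group_card : component_group dot Gamma f
  #= `I_(\prod_(i | d 0%R i != 0%R) `|d 0%R i|)%N.
Proof.
pose F := {dffun forall i : 'I_N, 'I_(m i)}.
have cardF : #|F| = (\prod_(i | d 0%R i != 0%R) `|d 0%R i|)%N.
  rewrite card_dep_ffun foldrE big_map big_enum /= [RHS]big_mkcond /=.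
  by apply: eq_bigr => i _; rewrite card_ord /m; case: eqP.
have mR i : (m i)%:R != 0 :> R by rewrite pnatr_eq0 -lt0n.
have [pt ptE] : exists pt : F -> t,
    forall k i, Y (pt k) i 0 = (k i)%:R / (m i)%:R.
  pose c (k : F) : 'cV[R]_N := \col_i ((k i)%:R / (m i)%:R).
  exists (fun k => sval (cid (Y_surj (c k)))) => k i.
  by case: cid => x /= ->; rewrite mxE.
have pt_inj : injective (coset \o pt).
  move=> k l /= /coset_eqP kl; apply/ffunP => i; apply: val_inj => /=.
  have [di|di] := eqVneq (d 0 i) 0.
    have mi : m i = 1%N by rewrite /m di eqxx.
    have z (j : 'I_(m i)) : j = 0%N :> nat.
      by have := ltn_ord j; rewrite {2}mi; case: (nat_of_ord j).
    by rewrite !z.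
  have := kl i di; rewrite !ptE -mulrBl => klint.
  have /eqP : ((k i)%:R - (l i)%:R) / (m i)%:R == 0 :> R.
    apply: contraT => /(norm_intr_ge1 klint).
    rewrite normrM normfV normr_nat ler_pdivlMr ?ltr0n // mul1r.
    apply: contraLR => _.
    rewrite -ltNge ltr_norml ltrBrDr [- _ + _]addrC !ltrBlDr.
    apply/andP; split.
      by rewrite ltr_wpDl // ltr_nat.
    by rewrite ltr_wpDr // ltr_nat.
  move/eqP; rewrite mulf_eq0 invr_eq0 (negbTE (mR i)) orbF subr_eq0 eqr_nat.
  by move/eqP.
have -> : component_group dot Gamma f = [set (coset \o pt) k | k in [set: F]].
  apply/seteqP; split=> [_ [X + <-]|_ [k _ <-]]; last first.
    exists (pi (pt k)) => //; apply/torus_fixedP => //; apply/fixedP => i.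
    have [->|di] := eqVneq (d 0 i) 0; first by rewrite mul0r.
    by rewrite abs_mul_int // ptE mulrCA divff // mulr1.
  have [x ->] := torus_pi_surj X => /torus_fixedP => /(_ fG)/fixedP xint.
  have kx i : exists k : 'I_(m i),
      d 0 i != 0 -> k%:R / (m i)%:R - Y x i 0 \is a Num.int.
    have [|di] := eqVneq (d 0 i) 0; first by exists (Ordinal (m_gt0 i)).
    have := xint i; rewrite abs_mul_int // => /intrP[z zE].
    have mz : (m i)%:Z != 0 by rewrite -lt0n.
    have zm : (`|(z %% m i)%Z| < m i)%N.
      by rewrite -ltz_nat gez0_abs ?modz_ge0 // ltz_pmod // ltz_nat.
    exists (Ordinal zm) => _ /=.
    rewrite (_ : Y x i 0 = z%:~R / (m i)%:R); last by rewrite -zE mulrC mulKf.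
    rewrite -mulrBl natr_absz ger0_norm ?modz_ge0 // -intrB.
    rewrite {2}(divz_eq z (m i)) opprD addrCA subrr addr0 rmorphN rmorphM /=.
    by rewrite mulNr -pmulrn mulfK // -rmorphN intr_int.
  exists (finfun (fun i => sval (cid (kx i))) : F) => //=.
  apply/coset_eqP => i di; rewrite ptE ffunE.
  by case: cid => k /=; apply.
rewrite -cardF.
apply: card_eq_trans (inj_card_eq _) _; first by move=> k l _ _; exact: pt_inj.
have enum_setT : [set: F] = [set enum_val i | i in [set: 'I_#|F|]].
  apply/seteqP; split=> // k _; exists (enum_rank k) => //; exact: enum_rankK.
rewrite enum_setT.
apply: card_eq_trans (inj_card_eq _) _.
  by move=> k l _ _; exact: enum_val_inj.
have -> : `I_#|F| = [set nat_of_ord i | i in [set: 'I_#|F|]].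
  by apply/seteqP; split=> [i /= iF|_ [i _ <-] /=]; [exists (Ordinal iF)|].
by rewrite card_eq_sym; apply: inj_card_eq => k l _ _; exact: val_inj.
Qed.
End ComponentCount.

(** * The displacement matrix in a basis of the dual lattice *)

(** The row space of [M], read as a subspace through the basis [e], is the
    image of a linear map on row vectors, injective when the rows of [M] are
    independent. *)
Section RowCombination.
Variables (F : fieldType) (vT : vectType F) (m : nat).
Variables (e : (\dim {:vT}).-tuple vT) (M : 'M[F]_(m, \dim {:vT})).

Definition row_comb (u : 'rV[F]_m) : vT := passmx.vecof e (u *m M).

Lemma row_comb_linear : linear row_comb.
Proof.
by move=> a u v; rewrite /row_comb mulmxDl -scalemxAl passmx.vecof_linear.
Qed.
HB.instance Definition _ :=
  GRing.isSemilinear.Build F 'rV[F]_m vT _ row_comb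
    (GRing.semilinear_linear row_comb_linear).
End RowCombination.

Lemma dim_vsof (F : fieldType) (vT : vectType F) (e : (\dim {:vT}).-tuple vT)
    (M : 'M[F]_(\dim {:vT})) :
  basis_of {:vT} e -> \dim (passmx.vsof e M) = \rank M.
Proof.
move=> eb; pose h := linfun (row_comb e (row_base M)).
have hE u : h u = row_comb e (row_base M) u by rewrite lfunE.
have -> : passmx.vsof e M = limg h.
  apply/vspaceP => v; rewrite -passmx.rVof_sub // -(eq_row_base M).
  apply/submxP/memv_imgP => [[u vu]|[u _ ->]].
    by exists u; rewrite ?memvf // hE /row_comb -vu passmx.rVofK.
  by exists u; rewrite hE /row_comb passmx.vecofK.
rewrite limg_dim_eq ?dimvf ?dim_matrix ?mul1r //.
apply/eqP; rewrite capfv; apply/lker0P => u v; rewrite !hE /row_comb.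
move=> /(can_inj (passmx.vecofK eb)); apply: row_free_inj.
exact: row_base_free.
Qed.

Lemma mxOver_int_unitl (R : realType) n (U : 'M[int]_n) (v : 'cV[R]_n) :
  U \in unitmx ->
  (map_mx intr U *m v \is a mxOver Num.int) = (v \is a mxOver Num.int).
Proof.
have intM (V : 'M[int]_n) (u : 'cV[R]_n) : u \is a mxOver Num.int ->
    map_mx intr V *m u \is a mxOver Num.int.
  by apply: mxOverM; apply/mxOverP => i j; rewrite mxE intr_int.
move=> uU; apply/idP/idP; last exact: intM.
by move=> /(intM (invmx U)); rewrite mulmxA -map_mxM mulVmx // map_mx1 mul1mx.
Qed.

(** The form pairs the displacement [x - f x] of an isometry with that of its
    inverse [f'], and [x - f' x] is, up to the invertible map [- f'], the same
    as [x - f x]. So the matrix of the displacement of [f] on the dual lattice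
    computes, after transposition, the dual coordinates of [x - f' x], which
    carry the same information on [x] as those of [x - f x]. *)
Section DisplacementMatrix.
Variables (R : realType) (t : vectType R) (dot : {dot t for idfun}).
Variables (Gamma : zmodClosed t) (f f' : 'End(t)).
Local Notation n := (\dim {:t}).
Variable b : n.-tuple t.
Hypothesis hb : lattice_basis (dual_lattice dot [set` Gamma]) b.
Hypothesis fK : cancel f f'.
Hypothesis f'K : cancel f' f.
Hypothesis f_iso : isometry dot dot f.
Hypothesis fG : {in Gamma, forall x, f x \in Gamma}.
Hypothesis f'G : {in Gamma, forall x, f' x \in Gamma}.

Lemma dot_displacement x y : dot (x - f x) y = dot x (y - f' y).
Proof. by rewrite linearBl linearBr /= -{2}(f'K y) f_iso. Qed.

(** By adjunction the displacement of [f] preserves the dual lattice as soon as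
    [f'] preserves [Gamma]. *)
Lemma displacement_int_mx : exists A : 'M[int]_n,
  map_mx intr A = (passmx.mxof b b (\1%VF - f))^T.
Proof.
exists (\matrix_(i, j) Num.floor (passmx.mxof b b (\1%VF - f) j i)).
apply/matrixP => i j; rewrite !mxE /= passmx.vecof_delta.
have dual_bj : dual_lattice dot [set` Gamma] (b`_j - f b`_j).
  move=> y yG; rewrite dot_displacement.
  by apply: (lattice_basis_mem j hb); rewrite /= rpredB // f'G.
have /(lattice_basisP _ hb)/(_ i) := dual_bj.
by rewrite !lfunE /= lfunE /= opp_lfunE intrEfloor => /eqP.
Qed.

Lemma dual_coord_displacement (A : 'M[int]_n) x :
  map_mx intr A = (passmx.mxof b b (\1%VF - f))^T ->
  dual_coord dot b (x - f' x) = map_mx intr A^T *m dual_coord dot b x.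
Proof.
move=> AE; rewrite -map_trmx AE trmxK; apply/colP => i; rewrite !mxE.
rewrite -dot_displacement.
rewrite {1}(coord_basis hb.1 (memvf (b`_i - f b`_i))) linear_sumlz.
apply: eq_bigr => j _; rewrite linearZl_LR !mxE /= passmx.vecof_delta.
by rewrite !lfunE /= lfunE /= opp_lfunE.
Qed.

Lemma displacement_inv_lattice x : (x - f' x \in Gamma) = (x - f x \in Gamma).
Proof.
apply/idP/idP => [/fG|/f'G]; rewrite linearB /= ?f'K ?fK => h.
  by rewrite -rpredN opprB.
by rewrite -rpredN opprB.
Qed.

Lemma displacement_inv_eq0 x : x - f' x = 0 <-> f x = x.
Proof.
split=> [/eqP|fx]; last by rewrite -{2}fx fK subrr.
by rewrite subr_eq0 => /eqP xf; rewrite {1}xf f'K.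
Qed.
End DisplacementMatrix.

(** * The component group and the minors *)

Lemma unitmx_map_intr (R : comUnitRingType) n (U : 'M[int]_n) :
  U \in unitmx -> map_mx intr U \in (unitmx : {pred 'M[R]_n}).
Proof. by rewrite !unitmxE det_map_mx; exact: rmorph_unit. Qed.

Lemma mul_intr_diag_mx (R : pzRingType) n (d : 'rV[int]_n) (v : 'cV[R]_n) i :
  (map_mx intr (diag_mx d) *m v) i 0 = (d 0 i)%:~R * v i 0.
Proof. by rewrite map_diag_mx mul_diag_mx !mxE. Qed.

Section Isometry.
Variables (R : realType) (t : vectType R) (dot : {dot t for idfun}).
Variables (Gamma : zmodClosed t) (f f' : 'End(t)).
Local Notation n := (\dim {:t}).
Variable b : n.-tuple t.
Hypothesis hGamma : full_rank_lattice [set` Gamma].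
Hypothesis hb : lattice_basis (dual_lattice dot [set` Gamma]) b.
Hypothesis fK : cancel f f'.
Hypothesis f'K : cancel f' f.
Hypothesis f_iso : isometry dot dot f.
Hypothesis fG : {in Gamma, forall x, f x \in Gamma}.
Hypothesis f'G : {in Gamma, forall x, f' x \in Gamma}.

(** Writing [A = L D U] in Smith form, [Y x = L^T (dual_coord x)] are the
    coordinates in which the displacement becomes diagonal: the factor [U^T]
    in front does not affect integrality or vanishing. Both sides then equal
    the product of the absolute values of the nonzero entries of [D]. *)
Lemma component_group_gcd_minors (A : 'M[int]_n) :
  map_mx intr A = (passmx.mxof b b (\1%VF - f))^T ->
  component_group dot Gamma f
    #= `I_(gcd_minors (\dim (limg (\1%VF - f)%R)) A).
Proof.
move=> AE; have [L [U [d [uL uU ALU [k kn dk]]]]] := smith_diag A.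
have rk : \dim (limg (\1%VF - f)%R) = k.
  rewrite (passmx.limgE hb.1) (dim_vsof _ hb.1) -mxrank_tr -AE ALU !map_mxM.
  rewrite mxrankMfree ?row_free_unit ?unitmx_map_intr //.
  rewrite -mxrank_tr trmx_mul.
  rewrite mxrankMfree ?row_free_unit ?unitmx_tr ?unitmx_map_intr //.
  by rewrite mxrank_tr (rank_intr_diag R kn dk).
rewrite rk ALU gcd_minors_unitr // gcd_minors_unitl // (gcd_minors_diag kn dk).
pose LR : 'M[R]_n := map_mx intr L^T; pose UR : 'M[R]_n := map_mx intr U^T.
pose Y : {linear t -> 'cV[R]_n} := mulmx LR \o dual_coord dot b.
have uLR : LR \in unitmx by apply: unitmx_map_intr; rewrite unitmx_tr.
have uUR : UR \in unitmx by apply: unitmx_map_intr; rewrite unitmx_tr.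
have Y_surj c : exists x, Y x = c.
  have [x xE] := dual_coord_surj dot (invmx LR *m c) hb.1.
  by exists x; rewrite /Y /= xE mulKVmx.
have YG x : (x \in Gamma) <-> Y x \is a mxOver Num.int.
  rewrite /Y /= mxOver_int_unitl ?unitmx_tr //.
  exact: (mem_lattice_dual_coord x hGamma hb).
have Yd x :
    dual_coord dot b (x - f' x) = UR *m (map_mx intr (diag_mx d) *m Y x).
  rewrite (dual_coord_displacement hb f'K f_iso _ AE) ALU /Y /= /UR /LR.
  by rewrite !trmx_mul tr_diag_mx !map_mxM !mulmxA.
have fixedP x : x - f x \in Gamma <->
    forall i, (d 0 i)%:~R * Y x i 0 \is a Num.int.
  rewrite -(displacement_inv_lattice fK f'K fG f'G).
  apply: iff_trans (mem_lattice_dual_coord _ hGamma hb) _.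
  rewrite Yd mxOver_int_unitl ?unitmx_tr //.
  split=> [/mxOverP h i|h]; first by have := h i 0; rewrite mul_intr_diag_mx.
  by apply/mxOverP => i j; rewrite ord1 mul_intr_diag_mx.
have kerP x : f x = x <-> forall i, d 0 i != 0 -> Y x i 0 = 0.
  apply: iff_trans (iff_sym (displacement_inv_eq0 fK f'K x)) _.
  split=> [x0 i di|h].
    have := Yd x; rewrite x0 linear0 => /esym/(congr1 (mulmx (invmx UR))).
    rewrite mulKmx // mulmx0 => /colP/(_ i).
    rewrite mul_intr_diag_mx [RHS]mxE => /eqP.
    by rewrite mulf_eq0 intr_eq0 (negbTE di) => /eqP.
  apply: (@dual_coord_eq0 _ _ dot _ _ hb.1).
  rewrite Yd (_ : _ *m Y x = 0) ?mulmx0 //.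
  apply/colP => i; rewrite mul_intr_diag_mx [RHS]mxE.
  by have [->|/h ->] := eqVneq (d 0 i) 0; rewrite ?mul0r ?mulr0.
apply: (@component_group_card _ _ _ _ _ _ Y) => // x.
apply: iff_trans (@torus_fixed1P _ _ _ _ _ _
  (fun i : 'I_n => b`_i - f b`_i) x fG _ _) _.
- move=> y; rewrite -(displacement_inv_lattice fK f'K fG f'G) => yG i.
  by rewrite (dot_displacement f'K f_iso); exact: (lattice_basis_mem i hb).
- move=> y y0; apply/(displacement_inv_eq0 fK f'K).
  apply: (@basis_dot_eq0 _ _ dot _ _ hb.1) => i.
  by rewrite -(dot_displacement f'K f_iso).
- split=> [[y /kerP y0 /YG/mxOverP xy] i di|xint].
  by have := xy i 0; rewrite linearB mxE [X in _ + X]mxE y0 // subr0.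
have [y yE] := Y_surj (\col_i (if d 0 i == 0 then Y x i 0 else 0)).
exists y; first by apply/kerP => i di; rewrite yE mxE (negbTE di).
apply/YG/mxOverP => i j.
rewrite ord1 linearB mxE [X in _ + X]mxE yE [X in - X]mxE.
by have [_|/xint] := eqVneq (d 0 i) 0; rewrite ?subrr ?rpred0 ?subr0.
Qed.
End Isometry.

Theorem theorem4 (R : realType) (t : vectType R) (dot : {dot t for idfun})
    (Gamma : zmodClosed t) (hGamma : full_rank_lattice [set` Gamma])
    (W : finGroupType) (rho : W -> 'End(t)) (hrho : orthogonal_rep dot rho)
    (hW : forall u : W, {in Gamma, forall x, rho u x \in Gamma})
    (w : W) (hw : rho w <> \1%VF)
    (b : (\dim {:t}).-tuple t)
    (hb : lattice_basis (dual_lattice dot [set` Gamma]) b) :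
  exists A : 'M[int]_(\dim {:t}),
    map_mx intr A = (passmx.mxof b b (\1%VF - rho w))^T /\
    component_group dot Gamma (rho w)
      #= `I_(gcd_minors (\dim (limg (\1%VF - rho w)%R)) A).
Proof.
have [rho1 rhoM rho_iso] := hrho.
have wK : cancel (rho w) (rho w^-1%g).
  by move=> x; rewrite -comp_lfunE -rhoM mulVg rho1 lfunE.
have w'K : cancel (rho w^-1%g) (rho w).
  by move=> x; rewrite -comp_lfunE -rhoM mulgV rho1 lfunE.
have [A AE] := displacement_int_mx hb w'K (rho_iso w) (hW w^-1%g).
exists A; split=> //.
exact: (component_group_gcd_minors hGamma hb wK w'K
  (rho_iso w) (hW w) (hW _) AE).
Qed.
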